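(* Let $p$ be a prime and let $n$ be a positive integer. Let $A\subseteq \mathbb F_p^n$ have density $\alpha=|A|/p^n>0$, and let $\varepsilon\in(0,1)$. Then there exists a linear subspace $W\le \mathbb F_p^n$ with $$\operatorname{codim}(W)\le \frac{2}{\varepsilon^2}\log\frac{1}{\alpha}$$ such that, if $g:\mathbb F_p^n\to\mathbb R$ is defined by $g(x)=\mathop{\mathbb E}\limits_{y\in x+W}\mathbf 1_A(y)$, then for every choice of functions $q_1,q_2,q_3,q_4:\mathbb F_p^n\to\mathbb C$ that are constant on the cosets of $W$ and satisfy $|q_i(x)|\le 1$ for all $x\in\mathbb F_p^n$ and all $i$, one has $$\left|\Lambda_4(q_1\mathbf 1_A,q_2\mathbf 1_A,q_3\mathbf 1_A,q_4\mathbf 1_A)-\Lambda_4(q_1g,q_2g,q_3g,q_4g)\right|\le \varepsilon^2\alpha^3 .$$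
   Context: For functions $f_1,f_2,f_3,f_4:\mathbb F_p^n\to\mathbb C$, $$\Lambda_4(f_1,f_2,f_3,f_4)=\mathop{\mathbb E}\limits_{x_1+x_2=x_3+x_4} f_1(x_1)f_2(x_2)\overline{f_3(x_3)f_4(x_4)},$$ where the average is uniform over all quadruples $(x_1,x_2,x_3,x_4)\in(\mathbb F_p^n)^4$ with $x_1+x_2=x_3+x_4$ (there are $p^{3n}$ of them). $\mathbf 1_A$ is the indicator function of $A$. $\mathbb{E}_{s\in S}$ denotes the uniform average over a finite non-empty set $S$. $\operatorname{codim}(W)=n-\dim(W)$. $\log$ is the natural logarithm. *)

(* Defs.v *)
From HB Require Import structures.
From mathcomp Require Import all_boot all_order all_algebra.
From mathcomp Require Import reals.
From mathcomp Require Import complex.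

Set Implicit Arguments.
Unset Strict Implicit.
Unset Printing Implicit Defensive.

Import Order.TTheory GRing.Theory Num.Theory.

Local Open Scope ring_scope.
Local Open Scope complex_scope.

(* Only meaningful for nonempty S (the value is 0 when S = set0). *)
Definition avg (K : fieldType) (T : finType) (S : {set T}) (F : T -> K) : K :=
  (#|S|%:R)^-1 * \sum_(s in S) F s.

Definition indic (K : pzSemiRingType) (T : finType) (A : {set T}) : T -> K :=
  fun x => (x \in A)%:R.

Section FpSpace.

Variables (p n : nat).
Local Notation V := 'rV['F_p]_n.

Definition density (R : realType) (A : {set V}) : R :=
  #|A|%:R / (p ^ n)%:R.

(* The truncated subtraction is harmless: \dim W <= n. *)
Definition codim (W : {vspace V}) : nat := (n - \dim W)%N.

Definition coset_of_vs (W : {vspace V}) (x : V) : {set V} :=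
  [set x + w | w in W].

Definition coset_avg (K : fieldType) (W : {vspace V}) (A : {set V}) : V -> K :=
  fun x => avg (coset_of_vs W x) (indic K A).

Definition constant_on_cosets (T : Type) (W : {vspace V}) (q : V -> T) : Prop :=
  forall x y : V, y \in coset_of_vs W x -> q y = q x.

Definition additive_quadruples : {set V * V * V * V} :=
  [set x | let: (x1, x2, x3, x4) := x in x1 + x2 == x3 + x4].

Definition Lambda4 (R : realType) (f1 f2 f3 f4 : V -> R[i]) : R[i] :=
  avg additive_quadruples
    (fun x => let: (x1, x2, x3, x4) := x in
       f1 x1 * f2 x2 * Num.conj (f3 x3 * f4 x4)).

End FpSpace.

(* Main.v *)
(** Entropy increment. For a subspace [W] let [g_W] be the average of [1_A] over
the cosets of [W], and consider [E g_W ln g_W], which lies between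
[alpha ln alpha] (attained at the whole space) and [0]. If some [U <= W] of
codimension at most one in [W] has [E |g_U - g_W| > eps alpha], then by
Pinsker's inequality passing from [W] to [U] raises this quantity by at least
[eps^2 alpha / 2]; so at most [2 eps^-2 ln (1 / alpha)] such steps are possible,
and the iteration stops at a [W] where no such [U] exists.

For this [W], expand [Lambda_4] in Fourier coefficients. At frequencies
vanishing on [W] the transforms of [q 1_A] and [q g_W] agree. At any other
frequency [r] the transform of [q g_W] vanishes, and with
[U = W :&: ker r] that of [q 1_A] equals that of [q (g_U - g_W)], hence is at
most [eps alpha] in absolute value. Two factors are bounded this way and the
other two by Parseval, which gives [(eps alpha)^2 alpha]. *)

From mathcomp Require Import all_boot all_order all_algebra.
From mathcomp Require Import zify ring lra.
From mathcomp Require Import boolp classical_sets reals topology normedtype derive realfun exp.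
From mathcomp Require Import complex.
Require Import Defs.

Set Implicit Arguments.
Unset Strict Implicit.
Unset Printing Implicit Defensive.

Import Order.TTheory GRing.Theory Num.Theory.
Import numFieldNormedType.Exports.

Local Open Scope ring_scope.

(** * Pinsker's inequality on a finite type *)

(** The difference of the two sides vanishes at [t = 1] and has derivative
    [(t - 1)^3 / (t^2 (t + 2)^2)], so it decreases before 1 and increases after it. At [t = a / b]
    this yields the pointwise form of Pinsker's inequality. *)
Lemma ln_ge_ratio (R : realType) (t : R) : 0 < t ->
  (t - 1) * (5 * t + 1) / (2 * t * (t + 2)) <= ln t.
Proof.
move=> t_gt0.
pose psi (s : R) := ln s - (s - 1) * (5 * s + 1) / (2 * s * (s + 2)).
pose dpsi (s : R) := (s - 1) ^+ 3 / (s ^+ 2 * (s + 2) ^+ 2).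
have dpsiE (s : R) : 0 < s -> is_derive s 1 psi (dpsi s).
  move=> s_gt0.
  have lnd := is_derive1_ln s_gt0.
  have s2 : 2 * s * (s + 2) != 0 by rewrite gt_eqF ?mulr_gt0 ?addr_gt0.
  have inv : is_derive s 1 (fun y : R => (2 * y * (y + 2))^-1) _ :=
    is_deriveV (f := fun y : R => 2 * y * (y + 2)) s2 _.
  apply: is_derive_eq.
  rewrite /dpsi /GRing.scale /=.
  field.
  by rewrite !gt_eqF ?addr_gt0.
have psi1 : psi 1 = 0 by rewrite /psi ln1 subrr !mul0r subr0.
have cont (a b : R) : 0 < a -> {within `[a, b], continuous psi}%classic.
  move=> a_gt0; apply: continuous_in_subspaceT => s; rewrite inE /= in_itv /= => /andP[as_ _].
  apply: differentiable_continuous; apply/derivable1_diffP.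
  by apply: ex_derive; apply: dpsiE; apply: lt_le_trans as_.
suff : 0 <= psi t by rewrite /psi subr_ge0.
have [t1|t1|->] := ltgtP t 1; last by rewrite psi1.
- have [s|c /[!in_itv]/= /andP[tc c1] E] := @MVT _ psi dpsi t 1 t1 _ (cont _ _ t_gt0).
    by rewrite in_itv /= => /andP[ts _]; apply: dpsiE; apply: lt_trans ts.
  rewrite psi1 sub0r in E; rewrite -(opprK (psi t)) E oppr_ge0.
  rewrite mulr_le0_ge0 ?subr_ge0 ?(ltW t1)// /dpsi mulr_le0_ge0//; last first.
    by rewrite invr_ge0 mulr_ge0 ?sqr_ge0.
  by rewrite exprS mulr_le0_ge0 ?sqr_ge0// subr_le0 ltW.
- have [s|c /[!in_itv]/= /andP[tc c1] E] := @MVT _ psi dpsi 1 t t1 _ (cont _ _ ltr01).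
    by rewrite in_itv /= => /andP[ts _]; apply: dpsiE; apply: lt_trans ts.
  rewrite psi1 subr0 in E; rewrite E.
  rewrite mulr_ge0 ?subr_ge0 ?(ltW t1)// /dpsi mulr_ge0//; last first.
    by rewrite invr_ge0 mulr_ge0 ?sqr_ge0.
  by rewrite exprn_ge0// subr_ge0 ltW.
Qed.

(* Tangent-line form, in the free parameter [l], of
   [a ln (a / b) - a + b >= 3 (a - b)^2 / (2 (a + 2 b))]: summing it and
   optimising [l] replaces the Cauchy-Schwarz step in Pinsker's inequality. *)
Lemma pinsker_pointwise (R : realType) (a b l : R) : 0 <= a -> 0 <= b -> (b = 0 -> a = 0) ->
  a - b + 3 * l * `|a - b| - 3 / 2 * l ^+ 2 * (a + 2 * b) <= a * ln a - a * ln b.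
Proof.
rewrite le_eqVlt => /predU1P[<-|a_gt0] b_ge0 ab0.
  (* At [a = 0] the logarithms disappear, and what remains is [b (3 l^2 - 3 l + 1) >= 0]. *)
  rewrite !mul0r subrr sub0r normrN (ger0_norm b_ge0).
  by have := sqr_ge0 (l - 1/2); nra.
have b_gt0 : 0 < b.
  by rewrite lt_neqAle b_ge0 andbT eq_sym; apply/eqP => /ab0 a0; rewrite a0 ltxx in a_gt0.
have ln_ab : (a - b) * (5 * a + b) / (2 * a * (a + 2 * b)) <= ln a - ln b.
  rewrite -ln_div ?posrE//; apply: le_trans (@ln_ge_ratio _ (a / b) _); last exact: divr_gt0.
  rewrite le_eqVlt; apply/orP; left; apply/eqP; field.
  by rewrite !gt_eqF// ?addr_gt0 ?mulr_gt0// ?addr_gt0 ?mulr_gt0 ?divr_gt0.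
have s_gt0 : 0 < a + 2 * b by rewrite addr_gt0 ?mulr_gt0.
rewrite -mulrBr; apply: le_trans (ler_wpM2l (ltW a_gt0) ln_ab).
rewrite (_ : a * _ = a - b + 3 / 2 * (`|a - b| ^+ 2 / (a + 2 * b))); last first.
  by rewrite real_normK ?num_real//; field; rewrite !gt_eqF.
suff : 2 * l * `|a - b| - l ^+ 2 * (a + 2 * b) <= `|a - b| ^+ 2 / (a + 2 * b) by lra.
rewrite ler_pdivlMr//.
by have := sqr_ge0 (`|a - b| - l * (a + 2 * b)); nra.
Qed.

(** Unnormalised: [f] and [g] only share their total mass. Since [ln 0 = 0] here, an infinite
    divergence cannot occur, and absolute continuity of [f] with respect to [g] is assumed
    instead. *)
Lemma pinsker (R : realType) (T : finType) (f g : T -> R) :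
  (forall x, 0 <= f x) -> (forall x, 0 <= g x) -> (forall x, g x = 0 -> f x = 0) ->
  \sum_x f x = \sum_x g x -> 0 < \sum_x g x ->
  (\sum_x `|f x - g x|) ^+ 2 / (2 * \sum_x g x) <=
    \sum_x (f x * ln (f x) - f x * ln (g x)).
Proof.
move=> f_ge0 g_ge0 fg0 fgE S_gt0.
set D := \sum_x `|_|; set S := \sum_x g x in fgE S_gt0 *.
(* The summed lower bound is [3 l D - 9/2 l^2 S]; this [l] maximises it, with value
   [D^2 / (2 S)]. *)
pose l := D / (3 * S).
apply: le_trans (ler_sum _ (fun x _ => pinsker_pointwise l (f_ge0 x) (g_ge0 x) (fg0 x))).
rewrite !big_split /= !sumrN -!mulr_sumr big_split /= -mulr_sumr fgE -/D -/S.
rewrite le_eqVlt; apply/orP; left; apply/eqP; rewrite /l; field.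
by rewrite gt_eqF.
Qed.

(** * Averages over the cosets of a subspace *)

Section CosetAverages.

Variables (p n : nat).
Local Notation V := 'rV['F_p]_n.
Implicit Types (W : {vspace V}) (A : {set V}).

Lemma sum_shift (M : nmodType) (T : finZmodType) (f : T -> M) (y : T) :
  \sum_x f (x + y) = \sum_x f x.
Proof. by rewrite [RHS](reindex_inj (addIr y)). Qed.

Lemma constant_on_cosetsP (T : Type) W (q : V -> T) :
  constant_on_cosets W q <-> forall x w, w \in W -> q (x + w) = q x.
Proof.
split=> [qW x w wW|qW x y /imsetP[w wW ->]]; last exact: qW.
by apply: qW; apply: imset_f.
Qed.

Lemma constant_on_subcosets (T : Type) W U (q : V -> T) :
  (U <= W)%VS -> constant_on_cosets W q -> constant_on_cosets U q.
Proof.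
move=> UW /constant_on_cosetsP qW; apply/constant_on_cosetsP => x w wU.
by apply: qW; apply: subvP wU.
Qed.

Lemma constant_on_cosetsM (K : pzSemiRingType) W (q h : V -> K) :
  constant_on_cosets W q -> constant_on_cosets W h ->
  constant_on_cosets W (fun x => q x * h x).
Proof. by move=> qW hW x y xy; rewrite (qW x)// (hW x). Qed.

Lemma sum_indic (K : pzSemiRingType) A : \sum_x indic K A x = #|A|%:R.
Proof. by rewrite -natr_sum -sum1_card [in RHS]big_mkcond. Qed.

Lemma coset_avgE (K : fieldType) W A x :
  coset_avg K W A x = #|W|%:R^-1 * \sum_(w in W) indic K A (x + w).
Proof.
have inj : injective (fun w : V => x + w) by apply: addrI.
rewrite /coset_avg /avg /coset_of_vs card_imset// big_imset//=.
by move=> ? ? _ _; apply: inj.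
Qed.

Lemma card_vspace_neq0 (K : numDomainType) W : #|W|%:R != 0 :> K.
Proof.
by rewrite pnatr_eq0 -lt0n; apply/card_gt0P; exists 0; apply: mem0v.
Qed.

Lemma coset_avg_constant (K : fieldType) W A :
  constant_on_cosets W (coset_avg K W A).
Proof.
apply/constant_on_cosetsP => x w wW; rewrite !coset_avgE; congr (_ * _).
rewrite [RHS](reindex_inj (addrI w)) /=.
by apply: eq_big => [y|y _]; rewrite ?rpredDl// addrA.
Qed.

(** Averaging over cosets is self-adjoint and fixes [h]: exchange the sums, then translate by each
    [w], which leaves [h] unchanged. *)
Lemma sum_coset_avg (K : numFieldType) W A (h : V -> K) :
  constant_on_cosets W h ->
  \sum_x h x * coset_avg K W A x = \sum_x h x * indic K A x.
Proof.
move=> /constant_on_cosetsP hW.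
under eq_bigr => x _ do rewrite coset_avgE mulrCA mulr_sumr.
rewrite -mulr_sumr exchange_big /=.
under eq_bigr => w wW.
  under eq_bigr => x _ do rewrite -(hW x w wW).
  rewrite (sum_shift (fun x => h x * indic K A x)).
  over.
by rewrite sumr_const -(mulr_natl (\sum_x _)) mulrA mulVf ?mul1r ?card_vspace_neq0.
Qed.

Lemma sum_coset_avg1 (K : numFieldType) W A : \sum_x coset_avg K W A x = #|A|%:R.
Proof.
rewrite -sum_indic.
have := @sum_coset_avg K W A (fun=> 1) (fun x y _ => erefl).
by under eq_bigr do rewrite mul1r; under [RHS]eq_bigr do rewrite mul1r.
Qed.

Lemma coset_avg_ge0 (K : numFieldType) W A x : 0 <= coset_avg K W A x.
Proof. by rewrite coset_avgE mulr_ge0 ?invr_ge0 ?sumr_ge0. Qed.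

Lemma coset_avg_le1 (K : numFieldType) W A x : coset_avg K W A x <= 1.
Proof.
rewrite coset_avgE ler_pdivrMl ?lt_def ?card_vspace_neq0 ?ler0n// mulr1.
by rewrite -natr_sum ler_nat -sum1_card leq_sum// => w _; apply: leq_b1.
Qed.

(** Source of the absolute continuity required by [pinsker]: if a coset of [W] misses [A], so do the
    cosets of any smaller [U] inside it. *)
Lemma coset_avg_eq0 (K : numFieldType) W A x :
  coset_avg K W A x = 0 <-> forall w, w \in W -> x + w \notin A.
Proof.
rewrite coset_avgE; split=> [/eqP|notA]; last first.
  rewrite big1 ?mulr0// => w /notA; rewrite /indic.
  by case: (_ \in A).
rewrite mulf_eq0 invr_eq0 (negPf (card_vspace_neq0 K W)) /=.
rewrite psumr_eq0// => /allP sum0 w wW.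
have := sum0 w (mem_index_enum w).
by rewrite wW /= /indic pnatr_eq0 eqb0.
Qed.

Lemma coset_avg_fullv (K : fieldType) A x :
  coset_avg K fullv A x = #|A|%:R / #|[set: V]|%:R.
Proof.
rewrite coset_avgE mulrC; congr (_ / _); last first.
  by congr _%:R; apply: eq_card => y; rewrite !inE memvf.
rewrite -sum_indic -(sum_shift _ x); apply: eq_big => [y|y _]; first by rewrite memvf.
by rewrite addrC.
Qed.

End CosetAverages.

(** * Entropy increment and its iteration *)

Section EntropyIncrement.

Variables (R : realType) (p n : nat).
Local Notation V := 'rV['F_p]_n.
Implicit Types (W U : {vspace V}) (A : {set V}).

(** A sum, hence the expectation [E g_W ln g_W] multiplied by the number of points of [V]. *)
Definition coset_entropy W A : R :=
  \sum_x coset_avg R W A x * ln (coset_avg R W A x).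

Lemma coset_entropy_le0 W A : coset_entropy W A <= 0.
Proof.
apply: sumr_le0 => x _.
by rewrite mulr_ge0_le0 ?coset_avg_ge0// ln_le0 ?coset_avg_le1.
Qed.

Lemma coset_entropy_fullv A : prime p ->
  coset_entropy fullv A = #|A|%:R * ln (density R A).
Proof.
move=> p_prime; rewrite /coset_entropy -(sum_coset_avg1 _ fullv) mulr_suml.
by apply: eq_bigr => x _; rewrite coset_avg_fullv cardsT card_mx mul1n card_Fp.
Qed.

(** The entropy difference is the divergence of [g_U] from [g_W]: as [ln g_W] is constant on cosets
    of [W], hence of [U], its sums against [g_U], [1_A] and [g_W] coincide. *)
Lemma coset_entropy_increment W U A : (U <= W)%VS -> (0 < #|A|)%N ->
  (\sum_x `|coset_avg R U A x - coset_avg R W A x|) ^+ 2 / (2 * #|A|%:R) <=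
    coset_entropy U A - coset_entropy W A.
Proof.
move=> UW A_gt0.
have sumW := sum_coset_avg1 R W A; have sumU := sum_coset_avg1 R U A.
rewrite -sumW; apply: le_trans.
  apply: (@pinsker _ _ (coset_avg R U A) (coset_avg R W A));
    rewrite ?sumW ?sumU ?ltr0n//; try by move=> ?; apply: coset_avg_ge0.
  move=> x /coset_avg_eq0 xW; apply/coset_avg_eq0 => w wU.
  by apply: xW; apply: subvP wU.
have lnW : constant_on_cosets W (fun x => ln (coset_avg R W A x)).
  by move=> x y /(coset_avg_constant R A) ->.
rewrite sumrB lerD2l lerN2 /coset_entropy.
under eq_bigr do rewrite mulrC.
rewrite (sum_coset_avg A lnW) -(sum_coset_avg A (constant_on_subcosets UW lnW)).
by under eq_bigr do rewrite mulrC.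
Qed.

Lemma exists_entropy_stable_subspace A (eps : R) : prime p -> (0 < #|A|)%N -> 0 < eps ->
  exists W : {vspace V},
    (codim W)%:R <= 2 / eps ^+ 2 * ln (1 / density R A) /\
    forall U, (U <= W)%VS -> (\dim W <= (\dim U).+1)%N ->
      \sum_x `|coset_avg R U A x - coset_avg R W A x| <= eps * #|A|%:R.
Proof.
move=> p_prime A_gt0 eps_gt0.
have A_gt0' : 0 < #|A|%:R :> R by rewrite ltr0n.
(* Invariant of the iteration: each unit of codimension is paid for by [eps^2 |A| / 2] of entropy
   gained since [fullv]. The total gain is at most [|A| ln (1 / alpha)]. *)
suff [W [HW stable]] : exists W, (codim W)%:R * (eps ^+ 2 * #|A|%:R / 2) <=
      coset_entropy W A - coset_entropy fullv A /\
    forall U, (U <= W)%VS -> (\dim W <= (\dim U).+1)%N ->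
      \sum_x `|coset_avg R U A x - coset_avg R W A x| <= eps * #|A|%:R.
  exists W; split=> //.
  have dens_gt0 : 0 < density R A.
    by rewrite divr_gt0// ltr0n expn_gt0 prime_gt0.
  have := le_trans HW (lerD (coset_entropy_le0 W A) (lexx _)).
  rewrite coset_entropy_fullv// div1r lnV ?posrE// => H.
  rewrite mulrAC ler_pdivlMr ?exprn_gt0//.
  by rewrite -(ler_pM2r A_gt0'); lra.
suff ind d W : (\dim W < d)%N ->
    (codim W)%:R * (eps ^+ 2 * #|A|%:R / 2) <= coset_entropy W A - coset_entropy fullv A ->
    exists W : {vspace V}, (codim W)%:R * (eps ^+ 2 * #|A|%:R / 2) <=
        coset_entropy W A - coset_entropy fullv A /\
      forall U, (U <= W)%VS -> (\dim W <= (\dim U).+1)%N ->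
        \sum_x `|coset_avg R U A x - coset_avg R W A x| <= eps * #|A|%:R.
  apply: (ind (\dim (fullv : {vspace V})).+1 fullv) => //.
  by rewrite /codim dimvf /dim /= mul1n subnn mul0r subrr.
elim: d W => // d IH W dW HW.
have [|/existsNP[U /not_implyP[UW /not_implyP[dU /negP]]]] :=
  pselect (forall U, (U <= W)%VS -> (\dim W <= (\dim U).+1)%N ->
        \sum_x `|coset_avg R U A x - coset_avg R W A x| <= eps * #|A|%:R).
  by exists W.
rewrite -ltNge => gt_sum.
apply: (IH U).
  (* The dimension drops strictly: otherwise [U = W], and the sum in [gt_sum] would be 0. *)
  rewrite -ltnS; apply: leq_trans dW; rewrite ltnS ltn_neqAle dimvS// andbT.
  apply/negP => /eqP dimE; have UE : U = W by apply/eqP; rewrite eqEdim UW dimE leqnn.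
  move: gt_sum; rewrite UE big1 => [|x _]; last by rewrite subrr normr0.
  by rewrite ltNge mulr_ge0 ?ltW.
have codimU : (codim U)%:R <= (codim W)%:R + 1 :> R.
  by rewrite natr1 ler_nat /codim; lia.
have step : eps ^+ 2 * #|A|%:R / 2 <= coset_entropy U A - coset_entropy W A.
  apply: le_trans (coset_entropy_increment UW A_gt0).
  rewrite ler_pdivlMr ?mulr_gt0//.
  rewrite [leLHS](_ : _ = (eps * #|A|%:R) ^+ 2); last by field.
  by rewrite lerXn2r ?nnegrE ?sumr_ge0 ?mulr_ge0 ?(ltW eps_gt0) ?(ltW gt_sum).
have c_ge0 : 0 <= eps ^+ 2 * #|A|%:R / 2 by rewrite !mulr_ge0 ?exprn_ge0 ?invr_ge0 ?(ltW eps_gt0).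
apply: le_trans (ler_wpM2r c_ge0 codimU) _.
by rewrite mulrDl mul1r; lra.
Qed.

End EntropyIncrement.

(** * Fourier analysis on [F_p^n] *)

(** Take a root of [1 + X + ... + X^(p-1)]; it is not 1, because the value at 1 is [p], nonzero in
    characteristic 0. *)
Lemma exists_nontrivial_root_of_unity (C : numClosedFieldType) (p : nat) : prime p ->
  exists z : C, z ^+ p = 1 /\ z != 1.
Proof.
move=> p_prime; have p_gt1 := prime_gt1 p_prime.
have size_p : size (\poly_(i < p) (1 : C)) = p by rewrite size_poly_eq ?oner_neq0.
have /closed_rootP[z /rootP] : size (\poly_(i < p) (1 : C)) != 1%N.
  by rewrite size_p gtn_eqF.
rewrite horner_poly; under eq_bigr do rewrite mul1r.
move=> sum0; exists z; split.
  by apply/eqP; rewrite -subr_eq0 subrX1 sum0 mulr0.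
apply/eqP => z1; move: sum0; rewrite z1; under eq_bigr do rewrite expr1n.
by rewrite sumr_const card_ord => /eqP; rewrite pnatr_eq0 gtn_eqF ?prime_gt0.
Qed.

Lemma mul_sums (R : pzSemiRingType) (S T : finType) (f : S -> R) (g : T -> R) :
  (\sum_x f x) * (\sum_y g y) = \sum_(t : S * T) f t.1 * g t.2.
Proof. by rewrite big_distrlr pair_bigA. Qed.

Section Fourier.

Variables (C : numClosedFieldType) (p n : nat) (z : C).
Hypotheses (p_prime : prime p) (z_root : z ^+ p = 1) (z_neq1 : z != 1).
Local Notation V := 'rV['F_p]_n.
Implicit Types (r x y : V) (f : V -> C) (W : {vspace V}).

Definition dot r x : 'F_p := (x *m r^T) 0 0.

(** The exponent is the natural number representing [dot r x]; additivity in [x] comes from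
    [z ^+ p = 1]. *)
Definition chi r x : C := z ^+ dot r x.

Definition fourier f r : C := #|{: V}|%:R^-1 * \sum_x f x * chi r x.

Lemma dotC r x : dot r x = dot x r.
Proof. by rewrite /dot -[x in LHS]trmxK -trmx_mul mxE. Qed.

Lemma chiC r x : chi r x = chi x r.
Proof. by rewrite /chi dotC. Qed.

Lemma chiDr r x y : chi r (x + y) = chi r x * chi r y.
Proof.
rewrite /chi /dot mulmxDl mxE -exprD /= -[RHS](expr_mod _ z_root).
(* Addition in ['F_p] reduces modulo an internal number that [Fp_cast] identifies with [p] for prime
   [p]. *)
by congr (_ ^+ _); congr (_ %% _)%N; apply: Fp_cast.
Qed.

Lemma chi0 r : chi r 0 = 1.
Proof. by rewrite /chi /dot mul0mx mxE. Qed.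

Lemma norm_chi r x : `|chi r x| = 1.
Proof.
rewrite normrX; suff -> : `|z| = 1 by rewrite expr1n.
by apply/eqP; rewrite -(pexpr_eq1 (prime_gt0 p_prime)) ?normr_ge0// -normrX z_root normr1.
Qed.

Lemma conj_chi r x : (chi r x)^* = chi r (- x).
Proof.
have chi_neq0 : chi r x != 0 by rewrite -normr_eq0 norm_chi oner_neq0.
by apply: (mulfI chi_neq0); rewrite -normCK norm_chi expr1n -chiDr subrr chi0.
Qed.

Lemma exists_chi_neq1 r x : dot r x != 0 -> exists c : 'F_p, chi r (c *: x) != 1.
Proof.
(* With this scalar the dot product becomes 1 and the character takes the value [z]. *)
move=> rx; exists (dot r x)^-1.
by rewrite /chi /dot -scalemxAl mxE mulVf.
Qed.

(** For [x != 0], translating [r] along a coordinate where [x] is nonzero multiplies the sum by a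
    character value other than 1. *)
Lemma sum_chi x : \sum_r chi r x = (x == 0)%:R * #|{: V}|%:R.
Proof.
have [->|x_neq0] := eqVneq; first by under eq_bigr do rewrite chi0; rewrite sumr_const mul1r.
have [i xi] : exists i, x 0 i != 0.
  by move: x_neq0 => /rV0Pn.
have [|c cx] := @exists_chi_neq1 x (delta_mx 0 i).
  by rewrite dotC /dot trmx_delta -colE mxE.
apply: (mulfI (_ : 1 - chi x (c *: delta_mx 0 i) != 0)); first by rewrite subr_eq0 eq_sym.
rewrite mul0r mulr0 mulrBl mul1r mulr_sumr.
apply/eqP; rewrite subr_eq0; apply/eqP.
rewrite -[LHS](sum_shift _ (c *: delta_mx 0 i)); apply: eq_bigr => r _.
by rewrite chiC chiDr mulrC (chiC r).
Qed.

Let N_neq0 : #|{: V}|%:R != 0 :> C.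
Proof. by rewrite pnatr_eq0 -lt0n; apply/card_gt0P; exists 0. Qed.

Lemma parseval f : \sum_r `|fourier f r| ^+ 2 = #|{: V}|%:R^-1 * \sum_x `|f x| ^+ 2.
Proof.
have sq r : `|fourier f r| ^+ 2 = #|{: V}|%:R^-1 ^+ 2 *
    \sum_(t : V * V) f t.1 * (f t.2)^* * chi r (t.1 - t.2).
  rewrite normrM exprMn ger0_norm ?invr_ge0// normCK rmorph_sum mul_sums.
  congr (_ * _); apply: eq_bigr => t _.
  by rewrite rmorphM /= conj_chi chiDr mulrACA.
under eq_bigr do rewrite sq.
rewrite -mulr_sumr exchange_big /= expr2 -mulrA; congr (_ * _).
under eq_bigr do rewrite -mulr_sumr sum_chi mulrA.
rewrite -mulr_suml mulrCA mulVf// mulr1.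
rewrite -(pair_bigA _ (fun x y => f x * (f y)^* * (x - y == 0)%:R)) /=.
apply: eq_bigr => x _; rewrite (bigD1 x)//= big1 => [|y yx].
  by rewrite subrr eqxx mulr1 addr0 normCK.
by rewrite subr_eq0 eq_sym (negPf yx) mulr0.
Qed.

Lemma card_additive_quadruples : #|additive_quadruples p n| = (#|{: V}| ^ 3)%N.
Proof.
rewrite (_ : additive_quadruples p n =
  [set (t, t.1.1 + t.1.2 - t.2) | t : V * V * V]).
  rewrite card_imset; first by rewrite !card_prod expnS expnS expn1 mulnA.
  by move=> s t [].
apply/setP => -[[[x1 x2] x3] x4]; rewrite !inE.
apply/eqP/imsetP => [E|[[[t1 t2] t3] _ [-> -> -> ->]]].
  by exists (x1, x2, x3) => //=; rewrite E addrAC subrr add0r.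
by rewrite addrCA subrr addr0.
Qed.

(** Expand the product of the four coefficients: by [sum_chi], summing over [r] selects the additive
    quadruples with weight [N], where [N] is the size of [V], and [N^-4 * N] is the inverse of their
    number [N^3]. *)
Lemma sum_additive_quadruples f1 f2 f3 f4 :
  avg (additive_quadruples p n) (fun t => let: (x1, x2, x3, x4) := t in
       f1 x1 * f2 x2 * (f3 x3 * f4 x4)^*) =
  \sum_r fourier f1 r * fourier f2 r * (fourier f3 r * fourier f4 r)^*.
Proof.
pose F (t : V * V * V * V) := f1 t.1.1.1 * f2 t.1.1.2 * (f3 t.1.2 * f4 t.2)^*.
have prodE r : fourier f1 r * fourier f2 r * (fourier f3 r * fourier f4 r)^* =
    #|{: V}|%:R^-1 ^+ 4 * \sum_t F t * chi r (t.1.1.1 + t.1.1.2 - (t.1.2 + t.2)).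
  rewrite rmorphM /fourier.
  rewrite !(rmorphM, rmorphV, rmorph_nat, rmorph_sum) ?unitfE//=.
  have regroup (a b c d e : C) :
      a * b * (a * c) * (a * d * (a * e)) = a ^+ 4 * (b * c * d * e) by ring.
  rewrite regroup.
  rewrite !mul_sums; congr (_ * _); apply: eq_bigr => t _.
  by rewrite /F opprD !chiDr -!conj_chi !rmorphM /=; ring.
under eq_bigr do rewrite prodE.
rewrite -mulr_sumr exchange_big /=.
under eq_bigr do rewrite -mulr_sumr sum_chi mulrA.
have cancel_card (a s : C) : a != 0 -> a^-1 ^+ 4 * (s * a) = (a ^+ 3)^-1 * s.
  by move=> a_neq0; field.
rewrite -mulr_suml cancel_card// /avg card_additive_quadruples natrX.
congr (_ * _); rewrite big_mkcond; apply: eq_bigr => -[[[x1 x2] x3] x4] _.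
by rewrite inE subr_eq0 /F /=; case: eqP; rewrite ?mulr1 ?mulr0.
Qed.

Lemma fourier_trivial W A (q : V -> C) r :
  constant_on_cosets W q -> (forall w, w \in W -> dot r w = 0) ->
  fourier (fun x => q x * indic C A x) r = fourier (fun x => q x * coset_avg C W A x) r.
Proof.
move=> qW rW; congr (_ * _).
under eq_bigr do rewrite mulrAC; under [RHS]eq_bigr do rewrite mulrAC.
rewrite (@sum_coset_avg _ _ _ W A (fun x => q x * chi r x))//.
apply/constant_on_cosetsP => x w wW; move/constant_on_cosetsP: qW => ->//.
by rewrite chiDr [chi r w]/chi rW// expr0 mulr1.
Qed.

(** Translation by a multiple of [w] preserves [f] but changes the coefficient by a nontrivial
    factor. *)
Lemma fourier_nontrivial W (f : V -> C) r w :
  constant_on_cosets W f -> w \in W -> dot r w != 0 -> fourier f r = 0.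
Proof.
move=> /constant_on_cosetsP fW wW /exists_chi_neq1[c cw].
apply: (mulfI (_ : 1 - chi r (c *: w) != 0)); first by rewrite subr_eq0 eq_sym.
rewrite mulr0 mulrBl mul1r /fourier mulrCA -mulrBr mulr_sumr.
rewrite -[X in X - _](sum_shift _ (c *: w)) -sumrB big1 ?mulr0// => x _.
by rewrite fW ?rpredZ// chiDr; ring.
Qed.

Lemma norm_fourier_le f r : `|fourier f r| <= #|{: V}|%:R^-1 * \sum_x `|f x|.
Proof.
rewrite normrM ger0_norm ?invr_ge0// ler_wpM2l ?invr_ge0//.
apply: le_trans (ler_norm_sum _ _ _) _.
by apply: ler_sum => x _; rewrite normrM norm_chi mulr1.
Qed.

(** Rank-nullity for the functional [dot r] restricted to [W], whose image has dimension at most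
    one. *)
Lemma exists_annihilated_hyperplane W r :
  exists U : {vspace V}, [/\ (U <= W)%VS, (\dim W <= (\dim U).+1)%N &
    forall u, u \in U -> dot r u = 0].
Proof.
pose phi : 'Hom(V, 'rV['F_p]_1) := linfun (mulmxr r^T).
exists (W :&: lker phi)%VS; split; first exact: capvSl.
  rewrite -(limg_ker_dim phi W) -[leqRHS]addn1 leq_add2l.
  by apply: leq_trans (dimvS (subvf _)) _; rewrite dimvf dim_matrix.
by move=> u; rewrite memv_cap memv_ker lfunE /= => /andP[_ /eqP]; rewrite /dot => ->; rewrite mxE.
Qed.

End Fourier.

Local Open Scope complex_scope.

(** * Comparison of the two values of [Lambda4] *)

Section Lambda4Approximation.

Variables (R : realType) (p n : nat).
Hypothesis p_prime : prime p.
Local Notation V := 'rV['F_p]_n.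
Local Notation N := (#|{: V}|%:R : R[i]).
Variables (A : {set V}) (W : {vspace V}) (delta : R).
Hypothesis stable : forall U : {vspace V}, (U <= W)%VS -> (\dim W <= (\dim U).+1)%N ->
  \sum_x `|coset_avg R U A x - coset_avg R W A x| <= delta * #|{: V}|%:R.
Variables (z : R[i]).
Hypotheses (z_root : z ^+ p = 1) (z_neq1 : z != 1).

Lemma coset_avg_complex (U : {vspace V}) x : (coset_avg R U A x)%:C = coset_avg R[i] U A x.
Proof.
rewrite !coset_avgE rmorphM fmorphV rmorph_nat rmorph_sum; congr (_ * _).
by apply: eq_bigr => w _; rewrite rmorph_nat.
Qed.

Lemma norm_real_complex (a : R) : `|a%:C| = `|a|%:C.
Proof. by rewrite normc_def /= expr0n /= addr0 sqrtr_sqr. Qed.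

Lemma fourier_away_annihilator (q : V -> R[i]) r w :
  constant_on_cosets W q -> (forall x, `|q x| <= 1) -> w \in W -> dot r w != 0 ->
  `|fourier z (fun x => q x * indic R[i] A x) r| <= delta%:C.
Proof.
move=> qW q_le1 wW rw.
have [U [UW dimU rU]] := exists_annihilated_hyperplane W r.
rewrite (fourier_trivial p_prime z_root A (constant_on_subcosets UW qW) rU).
have F0 : fourier z (fun x => q x * coset_avg R[i] W A x) r = 0.
  apply: (fourier_nontrivial p_prime z_root z_neq1 _ wW rw).
  exact: constant_on_cosetsM qW (coset_avg_constant _ _).
(* Subtracting this zero coefficient leaves the transform of [q (g_U - g_W)], which is bounded by
   the [L^1] norm that [stable] controls. *)
rewrite -[X in `|X|]subr0 -F0.
have -> : fourier z (fun x => q x * coset_avg R[i] U A x) r -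
    fourier z (fun x => q x * coset_avg R[i] W A x) r =
    fourier z (fun x => q x * (coset_avg R[i] U A x - coset_avg R[i] W A x)) r.
  rewrite /fourier -mulrBr -sumrB; congr (_ * _).
  by apply: eq_bigr => x _; rewrite mulrBr mulrBl.
apply: le_trans (norm_fourier_le p_prime z_root _ _) _.
rewrite ler_pdivrMl ?ltr0n; last by apply/card_gt0P; exists 0.
apply: (@le_trans _ _ (\sum_x `|coset_avg R U A x - coset_avg R W A x|)%:C); last first.
  by rewrite -(rmorph_nat (real_complex R)) -rmorphM lecR mulrC stable.
rewrite rmorph_sum; apply: ler_sum => x _.
rewrite -[leRHS]/(`|coset_avg R U A x - coset_avg R W A x|%:C) -norm_real_complex.
rewrite rmorphB /= !coset_avg_complex normrM.
by rewrite ler_piMl.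
Qed.

Lemma sum_sqr_fourier_le (q : V -> R[i]) : (forall x, `|q x| <= 1) ->
  \sum_r `|fourier z (fun x => q x * indic R[i] A x) r| ^+ 2 <= N^-1 * #|A|%:R.
Proof.
move=> q_le1; rewrite parseval// ler_wpM2l ?invr_ge0// -sum_indic.
apply: ler_sum => x _; rewrite normrM exprMn.
rewrite /indic; case: (x \in A); rewrite ?normr0 ?expr0n ?mulr0// normr1 expr1n mulr1.
exact: exprn_ile1.
Qed.

Lemma Lambda4_coset_avg_le (q1 q2 q3 q4 : V -> R[i]) :
  constant_on_cosets W q1 -> constant_on_cosets W q2 ->
  constant_on_cosets W q3 -> constant_on_cosets W q4 ->
  (forall x, `|q1 x| <= 1) -> (forall x, `|q2 x| <= 1) ->
  (forall x, `|q3 x| <= 1) -> (forall x, `|q4 x| <= 1) ->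
  `| Lambda4 (fun x => q1 x * indic R[i] A x) (fun x => q2 x * indic R[i] A x)
             (fun x => q3 x * indic R[i] A x) (fun x => q4 x * indic R[i] A x)
   - Lambda4 (fun x => q1 x * coset_avg R[i] W A x) (fun x => q2 x * coset_avg R[i] W A x)
             (fun x => q3 x * coset_avg R[i] W A x) (fun x => q4 x * coset_avg R[i] W A x) |
  <= delta%:C ^+ 2 * (N^-1 * #|A|%:R).
Proof.
move=> qW1 qW2 qW3 qW4 q1_le1 q2_le1 q3_le1 q4_le1.
pose F q r := fourier z (fun x => q x * indic R[i] A x) r.
pose G q r := fourier z (fun x => q x * coset_avg R[i] W A x) r.
rewrite /Lambda4 !(sum_additive_quadruples p_prime z_root z_neq1) -sumrB.
have delta_sqr_ge0 : 0 <= delta%:C ^+ 2 by rewrite -rmorphXn ler0c sqr_ge0.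
(* The factors with [q1], [q2] supply [delta^2]; the product of the other two is split into squares,
   ready for Parseval. *)
have termwise r : `|F q1 r * F q2 r * (F q3 r * F q4 r)^* -
    G q1 r * G q2 r * (G q3 r * G q4 r)^*| <=
    delta%:C ^+ 2 / 2 * (`|F q3 r| ^+ 2 + `|F q4 r| ^+ 2).
  have bound_ge0 : 0 <= delta%:C ^+ 2 / 2 * (`|F q3 r| ^+ 2 + `|F q4 r| ^+ 2).
    by rewrite mulr_ge0 ?addr_ge0 ?exprn_ge0// divr_ge0.
  have [/forallP rW|] := boolP [forall w, (w \in W) ==> (dot r w == 0)].
    have {}rW w : w \in W -> dot r w = 0 by move=> wW; apply/eqP/(implyP (rW w)).
    have FG q : constant_on_cosets W q -> F q r = G q r.
      by move=> qW; apply: fourier_trivial rW.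
    by rewrite [X in `|X|](_ : _ = 0) ?normr0// !FG// subrr.
  rewrite negb_forall => /existsP[w]; rewrite negb_imply => /andP[wW rw].
  (* One vanishing factor removes the whole second product. *)
  have -> : G q1 r = 0.
    apply: (fourier_nontrivial p_prime z_root z_neq1 _ wW rw).
    exact: constant_on_cosetsM qW1 (coset_avg_constant _ _).
  rewrite !mul0r subr0 normrM (normrM (F q1 r)) norm_conjC (normrM (F q3 r)).
  apply: (@le_trans _ _ (delta%:C * delta%:C * (`|F q3 r| * `|F q4 r|))).
    apply: ler_wpM2r; first exact: mulr_ge0.
    apply: ler_pM => //; first exact: (fourier_away_annihilator qW1 q1_le1 wW rw).
    exact: (fourier_away_annihilator qW2 q2_le1 wW rw).
  rewrite -expr2 -mulrA; apply: ler_wpM2l => //.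
  (* AM-GM. A square in [R[i]] need not be nonnegative, so the proof uses that norms are real. *)
  rewrite ler_pdivlMl// -subr_ge0.
  rewrite (_ : _ - _ = (`|F q3 r| - `|F q4 r|) ^+ 2); last by ring.
  by rewrite real_exprn_even_ge0// realB ?normr_real.
apply: le_trans (ler_norm_sum _ _ _) _.
apply: le_trans (ler_sum _ (fun r _ => termwise r)) _.
rewrite -mulr_sumr big_split /= -mulrA; apply: ler_wpM2l => //.
rewrite ler_pdivrMl// mulr_natl mulr2n.
by rewrite lerD ?sum_sqr_fourier_le.
Qed.

End Lambda4Approximation.

Theorem proposition1p5 (R : realType) (p n : nat) (p_prime : prime p)
    (n_gt0 : (0 < n)%N) (A : {set 'rV['F_p]_n}) (alpha eps : R)
    (alphaE : alpha = density R A) (alpha_gt0 : 0 < alpha)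
    (eps_gt0 : 0 < eps) (eps_lt1 : eps < 1) :
  exists W : {vspace 'rV['F_p]_n},
    (codim W)%:R <= 2 / eps ^+ 2 * ln (1 / alpha) /\
    let g : 'rV['F_p]_n -> R := coset_avg R W A in
    forall q1 q2 q3 q4 : 'rV['F_p]_n -> R[i],
      constant_on_cosets W q1 -> constant_on_cosets W q2 ->
      constant_on_cosets W q3 -> constant_on_cosets W q4 ->
      (forall x, `|q1 x| <= 1) -> (forall x, `|q2 x| <= 1) ->
      (forall x, `|q3 x| <= 1) -> (forall x, `|q4 x| <= 1) ->
      `| Lambda4 (fun x => q1 x * indic R[i] A x) (fun x => q2 x * indic R[i] A x)
                 (fun x => q3 x * indic R[i] A x) (fun x => q4 x * indic R[i] A x)
       - Lambda4 (fun x => q1 x * (g x)%:C) (fun x => q2 x * (g x)%:C)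
                 (fun x => q3 x * (g x)%:C) (fun x => q4 x * (g x)%:C) |
      <= (eps ^+ 2 * alpha ^+ 3)%:C.
Proof.
have cardV : #|{: 'rV['F_p]_n}| = (p ^ n)%N by rewrite card_mx mul1n card_Fp.
have pn_neq0 : (p ^ n)%:R != 0 :> R by rewrite pnatr_eq0 -lt0n expn_gt0 prime_gt0.
have cardA : #|A|%:R = alpha * (p ^ n)%:R by rewrite alphaE /density divfK.
have A_gt0 : (0 < #|A|)%N.
  rewrite lt0n; apply: contraTneq alpha_gt0 => A0.
  by rewrite alphaE /density A0 mul0r ltxx.
have [W [codimW stable]] := exists_entropy_stable_subspace p_prime A_gt0 eps_gt0.
exists W; rewrite alphaE; split=> // g q1 q2 q3 q4 qW1 qW2 qW3 qW4 q1_le1 q2_le1 q3_le1 q4_le1.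
have [z [z_root z_neq1]] := exists_nontrivial_root_of_unity R[i] p_prime.
(* Here [|A| = alpha * p^n] turns the stability bound into the one with [delta = eps * alpha]; the
   final bound is then [(eps alpha)^2 alpha]. *)
have stableN (U : {vspace 'rV['F_p]_n}) : (U <= W)%VS -> (\dim W <= (\dim U).+1)%N ->
    \sum_x `|coset_avg R U A x - coset_avg R W A x| <= eps * alpha * #|{: 'rV['F_p]_n}|%:R.
  by rewrite cardV -mulrA -cardA; apply: stable.
have gE (q : 'rV['F_p]_n -> R[i]) :
    (fun x => q x * (g x)%:C) = fun x => q x * coset_avg R[i] W A x.
  by apply: funext => x; rewrite coset_avg_complex.
rewrite -alphaE !gE.
apply: le_trans (Lambda4_coset_avg_le p_prime stableN z_root z_neq1 qW1 qW2 qW3 qW4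
  q1_le1 q2_le1 q3_le1 q4_le1) _.
rewrite cardV -!(rmorph_nat (real_complex R)) -fmorphV -rmorphXn -!rmorphM lecR cardA.
rewrite le_eqVlt; apply/orP; left; apply/eqP; field.
exact: pn_neq0.
Qed.
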